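(* Let a circle in the Euclidean plane have diameter $AB$ and radius $r$. Produce $AB$ beyond $A$ to the point $C$ with $AC = r$ (so $A$ lies between $C$ and $B$ and $BC = 3r$). Let a line through $C$, other than the line $AB$, cut the circle in two points, let $E$ be the second of them (the one farther from $C$), and let this line meet the tangent to the circle at $B$ in the point $L$. Then the part $BL$ of the tangent is less than the adjacent intercepted arc: $$BL < \overset{\frown}{BE}.$$
   Context: $BL$ denotes the length of the straight segment from $B$ to $L$, and $\overset{\frown}{BE}$ denotes the length of the arc of the circle from $B$ to $E$ that is less than a semicircle. *)

(* Defs.v *)
From Stdlib Require Import Reals.
From Coquelicot Require Import Coquelicot.
Open Scope R_scope.

Definition point : Type := (R * R)%type.

Definition distance (P Q : point) : R :=
  dist_euc (fst P) (snd P) (fst Q) (snd Q).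

Definition affine_point (P Q : point) (t : R) : point :=
  (fst P + t * (fst Q - fst P), snd P + t * (snd Q - snd P)).

Definition between (P X Q : point) : Prop :=
  exists t : R, 0 < t < 1 /\ X = affine_point P Q t.

Definition line (P Q : point) (X : point) : Prop :=
  exists t : R, X = affine_point P Q t.

Definition same_set (l m : point -> Prop) : Prop := forall X, l X <-> m X.

Definition is_line (l : point -> Prop) : Prop :=
  exists P Q : point, P <> Q /\ same_set l (line P Q).

Definition circle (O : point) (r : R) (X : point) : Prop := distance O X = r.

Definition is_diameter (O : point) (r : R) (P Q : point) : Prop :=
  circle O r P /\ circle O r Q /\ P <> Q /\ line P Q O.

Definition is_tangent_at (O : point) (r : R) (P : point) (m : point -> Prop)
  : Prop :=
  is_line m /\ forall X, (m X /\ circle O r X) <-> X = P.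

Definition circle_point (O : point) (r t : R) : point :=
  (fst O + r * cos t, snd O + r * sin t).

(* [x] is the length of a polygonal line with n + 1 sides inscribed in the
   curve [g] restricted to [a, b]; [sum_f_R0 f n] has the terms f 0, ..., f n. *)
Definition inscribed_length (g : R -> point) (a b x : R) : Prop :=
  exists (n : nat) (t : nat -> R),
    t 0%nat = a /\ t (S n) = b /\
    (forall i, (i <= n)%nat -> t i <= t (S i)) /\
    x = sum_f_R0 (fun i => distance (g (t i)) (g (t (S i)))) n.

(* Supremum of the lengths of the polygonal lines inscribed in the arc that
   joins [P] and [Q] and is less than a semicircle. The arc may run
   counterclockwise from [P] to [Q] or from [Q] to [P]; the angles [a], [b] are
   determined up to a common multiple of 2 PI. If [P] and [Q] are antipodal
   there is no such arc, and the value is the default 0. *)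
Definition minor_arc_length (O : point) (r : R) (P Q : point) : R :=
  real (Lub_Rbar (fun x => exists a b : R,
    a <= b < a + PI /\
    ((circle_point O r a = P /\ circle_point O r b = Q) \/
     (circle_point O r a = Q /\ circle_point O r b = P)) /\
    inscribed_length (circle_point O r) a b x)).

(* Main.v *)
Require Import Defs.
From Stdlib Require Import Reals Lra Lia.
From Coquelicot Require Import Coquelicot.
Open Scope R_scope.

(** With [O] as origin, [B] at angle 0 and [E] at angle [phi], we have
    [C = -2B], and similar triangles give [BL = 3 r |sin phi| / (2 + cos phi)],
    whereas the arc has length [r |phi|]. The claim is therefore the
    Snell-Cusanus inequality [3 sin x < x (2 + cos x)], which holds because
    [x - 3 sin x / (2 + cos x)] has derivative
    [((1 - cos x) / (2 + cos x))^2]. *)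

(** * The Snell-Cusanus inequality *)

Lemma cos_lt_1 (x : R) : 0 < x <= PI -> cos x < 1.
Proof.
  intros Hx. rewrite <- cos_0. apply cos_decreasing_1; lra.
Qed.

Lemma snell_cusanus (x : R) : 0 < x <= PI -> 3 * sin x < x * (2 + cos x).
Proof.
  intros Hx.
  destruct (MVT_cor2 (fun y => y - 3 * sin y / (2 + cos y))
              (fun y => ((1 - cos y) / (2 + cos y)) ^ 2) 0 x) as [c [Hc Hcx]].
  - lra.
  - intros c _. apply is_derive_Reals.
    pose proof (COS_bound c).
    auto_derive; [lra|].
    pose proof (sin2_cos2 c) as Hsc. unfold Rsqr in Hsc.
    field_simplify; try lra. f_equal. nra.
  - rewrite sin_0, cos_0 in Hc.
    pose proof (COS_bound c). pose proof (COS_bound x).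
    (* The mean value point lies strictly inside the interval, so the derivative there is positive;
       this gives strictness. *)
    assert (cos c < 1) by (apply cos_lt_1; lra).
    assert (0 < (1 - cos c) / (2 + cos c)) by (apply Rdiv_lt_0_compat; lra).
    assert (0 < ((1 - cos c) / (2 + cos c)) ^ 2 * (x - 0))
      by (apply Rmult_lt_0_compat; [apply pow_lt; assumption | lra]).
    assert (3 * sin x / (2 + cos x) < x) by lra.
    apply (Rmult_lt_reg_r (/ (2 + cos x))); [apply Rinv_0_lt_compat; lra|].
    replace (x * (2 + cos x) * / (2 + cos x)) with x by (field; lra).
    assumption.
Qed.

Lemma Rabs_sin_le (x : R) : 0 <= x -> Rabs (sin x) <= x.
Proof.
  intros Hx. pose proof (SIN_bound x). pose proof PI2_1.
  destruct (Rle_lt_or_eq_dec 0 x Hx) as [H1|<-].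
  - pose proof (sin_lt_x x H1). apply Rabs_le. split; [|lra].
    destruct (Rle_lt_dec x PI); [|lra].
    pose proof (sin_ge_0 x). lra.
  - rewrite sin_0, Rabs_R0. lra.
Qed.

Lemma unit_vector_angle (x y : R) :
  x ^ 2 + y ^ 2 = 1 -> exists t, - PI <= t <= PI /\ cos t = x /\ sin t = y.
Proof.
  intros H.
  assert (Hx : -1 <= x <= 1) by nra.
  pose proof (acos_bound x).
  assert (Hs : sin (acos x) = Rabs y).
  { rewrite sin_acos by lra. rewrite <- sqrt_Rsqr_abs. f_equal.
    unfold Rsqr; lra. }
  destruct (Rle_lt_dec 0 y).
  - exists (acos x). rewrite Rabs_pos_eq in Hs by assumption.
    rewrite cos_acos by lra. repeat split; lra.
  - exists (- acos x). rewrite Rabs_left in Hs by assumption.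
    rewrite cos_neg, sin_neg, cos_acos by lra. repeat split; lra.
Qed.

(** * Distances, chords and the length of an arc *)

Lemma distance_eq (P Q : point) (d : R) :
  0 <= d -> (fst P - fst Q) ^ 2 + (snd P - snd Q) ^ 2 = d ^ 2 ->
  distance P Q = d.
Proof.
  intros Hd H. unfold distance, dist_euc.
  rewrite <- (sqrt_Rsqr d Hd). f_equal. unfold Rsqr. lra.
Qed.

Lemma distance_sqr (P Q : point) :
  distance P Q ^ 2 = (fst P - fst Q) ^ 2 + (snd P - snd Q) ^ 2.
Proof.
  unfold distance, dist_euc. rewrite <- Rsqr_pow2, Rsqr_sqrt.
  - unfold Rsqr. ring.
  - pose proof (Rle_0_sqr (fst P - fst Q)).
    pose proof (Rle_0_sqr (snd P - snd Q)). lra.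
Qed.

Lemma chord_length (O : point) (r s t : R) :
  0 <= r ->
  distance (circle_point O r s) (circle_point O r t)
  = 2 * r * Rabs (sin ((t - s) / 2)).
Proof.
  intros Hr. apply distance_eq.
  - pose proof (Rabs_pos (sin ((t - s) / 2))). nra.
  - rewrite Rpow_mult_distr, <- (Rsqr_pow2 (Rabs _)), <- Rsqr_abs. cbn.
    (* In half-difference and half-sum the coordinate differences become, up to sign,
       [2 * r * sin u * sin v] and [2 * r * sin u * cos v]. *)
    set (u := (t - s) / 2). set (v := (t + s) / 2).
    replace s with (v - u) by (unfold u, v; field).
    replace t with (v + u) by (unfold u, v; field).
    rewrite cos_plus, cos_minus, sin_plus, sin_minus.
    pose proof (sin2_cos2 v) as Hv. unfold Rsqr in *.
    transitivity (4 * r * r * (sin u * sin u)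
                  * (sin v * sin v + cos v * cos v)); [ring|].
    rewrite Hv. ring.
Qed.

Lemma sum_f_R0_telescope (f : nat -> R) (n : nat) :
  sum_f_R0 (fun i => f (S i) - f i) n = f (S n) - f 0%nat.
Proof.
  induction n as [|n IH]; simpl; [|rewrite IH]; ring.
Qed.

(** Each chord is at most the arc it subtends, and the angle steps telescope. *)
Lemma inscribed_length_le (O : point) (r a b x : R) :
  0 <= r -> inscribed_length (circle_point O r) a b x -> x <= r * (b - a).
Proof.
  intros Hr (n & t & Ha & Hb & Ht & ->).
  rewrite <- Ha, <- Hb, <- sum_f_R0_telescope, scal_sum.
  apply sum_Rle. intros i Hi.
  rewrite chord_length by assumption. specialize (Ht i Hi).
  pose proof (Rabs_sin_le ((t (S i) - t i) / 2)). nra.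
Qed.

Lemma regular_inscribed_length (O : point) (r a h : R) (n : nat) :
  0 <= r -> 0 <= h ->
  inscribed_length (circle_point O r) a (a + h)
    (2 * r * Rabs (sin (h / 2 * / INR (S n))) * INR (S n)).
Proof.
  intros Hr Hh.
  assert (Hn : 0 < INR (S n)) by (apply lt_0_INR; lia).
  assert (Hn' : 0 < / INR (S n)) by (apply Rinv_0_lt_compat; assumption).
  exists n, (fun i => a + INR i * (h * / INR (S n))). repeat split.
  - simpl INR. ring.
  - field. lra.
  - intros i _. cbv beta. rewrite (S_INR i).
    assert (0 <= h * / INR (S n)) by (apply Rmult_le_pos; lra). lra.
  - rewrite <- sum_cte. apply sum_eq. intros i _.
    rewrite chord_length by assumption. rewrite (S_INR i).
    do 3 f_equal. field. lra.
Qed.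

(** With [u = h / 2 * / INR (S n)] the term is [r * h * Rabs (sin u / u)], and [sin u / u] tends to
    1. *)
Lemma regular_inscribed_length_lim (r h : R) :
  0 < h ->
  is_lim_seq (fun n => 2 * r * Rabs (sin (h / 2 * / INR (S n))) * INR (S n))
    (r * h).
Proof.
  intros Hh.
  assert (Hpos : forall n, 0 < / INR (S n))
    by (intros n; apply Rinv_0_lt_compat, lt_0_INR; lia).
  assert (Hu : is_lim_seq (fun n => h / 2 * / INR (S n)) 0).
  { replace (Finite 0) with (Rbar_mult (h / 2) 0) by (simpl; f_equal; ring).
    apply is_lim_seq_scal_l.
    apply (is_lim_seq_incr_1 (fun n => / INR n)).
    apply (is_lim_seq_inv INR p_infty); [apply is_lim_seq_INR | easy]. }
  assert (Hs : is_lim_seq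
    (fun n => sin (h / 2 * / INR (S n)) / (h / 2 * / INR (S n))) 1).
  { apply (is_lim_comp_seq (fun x => sin x / x) _ 0 1 is_lim_sinc_0);
      [|exact Hu].
    exists 0%nat. intros n _ H. apply Rbar_finite_eq in H.
    specialize (Hpos n). nra. }
  apply is_lim_seq_abs in Hs.
  apply (is_lim_seq_scal_l _ (r * h)) in Hs.
  change (Rbar_mult (r * h) (Rbar_abs 1)) with (Finite (r * h * Rabs 1)) in Hs.
  rewrite Rabs_R1, Rmult_1_r in Hs.
  refine (is_lim_seq_ext _ _ _ _ Hs). intros n. specialize (Hpos n).
  assert (0 < INR (S n)) by (apply lt_0_INR; lia).
  assert (0 < h / 2 * / INR (S n)) by (apply Rmult_lt_0_compat; lra).
  rewrite Rabs_div, (Rabs_pos_eq (h / 2 * / INR (S n))) by lra.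
  field. lra.
Qed.

Lemma minor_arc_length_ge (O P Q : point) (r a h : R) :
  0 <= r -> 0 < h < PI ->
  (circle_point O r a = P /\ circle_point O r (a + h) = Q) \/
  (circle_point O r a = Q /\ circle_point O r (a + h) = P) ->
  r * h <= minor_arc_length O r P Q.
Proof.
  intros Hr Hh HPQ. unfold minor_arc_length.
  match goal with |- context [Lub_Rbar ?F] =>
    destruct (Lub_Rbar_correct F) as [Hub Hlub]; set (S := F) in *
  end.
  assert (HS : forall n : nat,
    S (2 * r * Rabs (sin (h / 2 * / INR (Datatypes.S n)))
       * INR (Datatypes.S n))).
  { intros n. exists a, (a + h). split; [lra|]. split; [exact HPQ|].
    apply regular_inscribed_length; lra. }
  (* [real] sends infinite values to 0, so the supremum must be shown finite: an admissible angle
     range is shorter than [PI]. *)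
  assert (Hle : Rbar_le (Lub_Rbar S) (r * PI)).
  { apply Hlub. intros x (a' & b' & Hab & _ & Hx).
    apply inscribed_length_le in Hx; [|assumption]. simpl. nra. }
  destruct (Lub_Rbar S) as [s| |].
  - apply (is_lim_seq_le _ (fun _ => s) (r * h) s (fun n => Hub _ (HS n))).
    + apply regular_inscribed_length_lim; lra.
    + apply is_lim_seq_const.
  - contradiction.
  - destruct (Hub _ (HS 0%nat)).
Qed.

(** * Lines, diameters and tangents in coordinates *)

Lemma line_unique (P Q X Y : point) :
  X <> Y -> line P Q X -> line P Q Y -> same_set (line P Q) (line X Y).
Proof.
  intros HXY [s ->] [t ->] Z.
  assert (Hst : t - s <> 0).
  { intros H. apply HXY. replace t with s by lra. reflexivity. }
  split; intros [u ->].
  - exists ((u - s) / (t - s)).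
    unfold affine_point; simpl; f_equal; field; assumption.
  - exists (s + u * (t - s)).
    unfold affine_point; simpl; f_equal; ring.
Qed.

Lemma is_line_through (l : point -> Prop) (X Y : point) :
  is_line l -> X <> Y -> l X -> l Y -> same_set l (line X Y).
Proof.
  intros (P & Q & _ & Hl) HXY HX HY Z.
  rewrite (Hl Z). apply line_unique; [assumption | now apply Hl ..].
Qed.

(** If [O] has parameter [t] on [A B], equal distances to the endpoints give [t ^ 2 = (1 - t) ^ 2],
    as [A] and [B] differ. *)
Lemma diameter_midpoint (O A B : point) (r : R) :
  is_diameter O r A B -> O = affine_point A B (1 / 2).
Proof.
  intros (HA & HB & HAB & [t Ht]). rewrite Ht. f_equal.
  unfold circle in *.
  pose proof (distance_sqr O A) as H1. pose proof (distance_sqr O B) as H2.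
  rewrite HA in H1. rewrite HB in H2. rewrite H1, Ht in H2.
  destruct A as [a1 a2], B as [b1 b2]; simpl in *.
  assert (Hd : (b1 - a1) ^ 2 + (b2 - a2) ^ 2 <> 0).
  { intros H. rewrite <- !Rsqr_pow2 in H. apply Rplus_sqr_eq_0 in H.
    apply HAB. f_equal; lra. }
  assert (H3 : (2 * t - 1) * ((b1 - a1) ^ 2 + (b2 - a2) ^ 2) = 0) by lra.
  apply Rmult_integral in H3. lra.
Qed.

(* A line that meets the circle at [B] obliquely meets it again at the
   reflection of [B] in the foot of the perpendicular from [O]. *)
Lemma tangent_orthogonal (O B L : point) (r : R) (m : point -> Prop) :
  is_tangent_at O r B m -> m L ->
  (fst L - fst B) * (fst B - fst O) + (snd L - snd B) * (snd B - snd O) = 0.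
Proof.
  intros [Hm Hmeet] HL.
  destruct (proj2 (Hmeet B) eq_refl) as [HB HBO].
  destruct (Req_dec ((fst L - fst B) ^ 2 + (snd L - snd B) ^ 2) 0) as [H0|H0].
  { rewrite <- !Rsqr_pow2 in H0. apply Rplus_sqr_eq_0 in H0.
    destruct H0 as [-> ->]. ring. }
  assert (HBL : B <> L) by (intros ->; apply H0; ring).
  pose proof (is_line_through m B L Hm HBL HB HL) as Hline.
  set (d := (fst L - fst B) * (fst B - fst O)
            + (snd L - snd B) * (snd B - snd O)) in *.
  set (q := (fst L - fst B) ^ 2 + (snd L - snd B) ^ 2) in *.
  (* The squared distance from [O] at parameter [k] is [r ^ 2 + 2 * k * d + k ^ 2 * q]; this [k] is
     the root other than 0. *)
  set (k := - 2 * d / q).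
  assert (Hk : k * q = - 2 * d) by (unfold k; field; assumption).
  clearbody k.
  assert (HX : affine_point B L k = B).
  { apply Hmeet. split; [apply Hline; eexists; reflexivity|].
    unfold circle in *. apply distance_eq.
    - rewrite <- HBO. apply sqrt_pos.
    - rewrite <- HBO, distance_sqr. simpl fst; simpl snd.
      apply (f_equal (Rmult k)) in Hk. unfold d, q in Hk. lra. }
  pose proof (f_equal fst HX) as H1. pose proof (f_equal snd HX) as H2.
  simpl in H1, H2.
  assert (Hkq : k * q = k * (fst L - fst B) * (fst L - fst B)
                        + k * (snd L - snd B) * (snd L - snd B))
    by (unfold q; ring).
  replace (k * (fst L - fst B)) with 0 in Hkq by lra.
  replace (k * (snd L - snd B)) with 0 in Hkq by lra.
  lra.
Qed.

Lemma produced_diameter_point (O A B C : point) (r : R) :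
  0 < r -> is_diameter O r A B -> between C A B -> distance A C = r ->
  C = affine_point O B (- 2).
Proof.
  intros Hr HAB (t & Ht & HA) HAC.
  pose proof (diameter_midpoint _ _ _ _ HAB) as HO.
  destruct HAB as (HOA & _). unfold circle in HOA.
  pose proof (distance_sqr O A) as H1. pose proof (distance_sqr A C) as H2.
  rewrite HOA in H1. rewrite HAC in H2.
  destruct O as [o1 o2], A as [a1 a2], B as [b1 b2], C as [c1 c2].
  unfold affine_point in *; simpl in *.
  injection HO; intros. injection HA; intros. clear HO HA.
  (* [(1 - t) (A - C) = 2 t (O - A)], and both vectors have length [r]. *)
  assert (E1 : (1 - t) * (a1 - c1) = 2 * t * (o1 - a1)) by nra.
  assert (E2 : (1 - t) * (a2 - c2) = 2 * t * (o2 - a2)) by nra.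
  assert (E3 : (1 - t) ^ 2 * r ^ 2 = (2 * t) ^ 2 * r ^ 2).
  { transitivity ((1 - t) ^ 2 * ((a1 - c1) ^ 2 + (a2 - c2) ^ 2));
      [f_equal; exact H2|].
    transitivity (((1 - t) * (a1 - c1)) ^ 2 + ((1 - t) * (a2 - c2)) ^ 2);
      [ring|]. rewrite E1, E2.
    transitivity ((2 * t) ^ 2 * ((o1 - a1) ^ 2 + (o2 - a2) ^ 2));
      [ring | f_equal; symmetry; exact H1]. }
  assert (0 < r ^ 2) by (apply pow_lt; assumption).
  assert (E4 : (1 - t) ^ 2 = (2 * t) ^ 2)
    by (apply (Rmult_eq_reg_r (r ^ 2)); lra).
  (* The other root, [t = -1], is excluded by [0 < t]. *)
  assert (Et : t = 1 / 3) by nra.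
  subst t. f_equal; lra.
Qed.

(** Angles are measured from a base direction [b], later that of [B]; the range of [t] makes its
    absolute value the angle of the shorter arc. *)
Lemma circle_point_polar (O X : point) (r b : R) :
  0 < r -> circle O r X ->
  exists t, - PI <= t <= PI /\ X = circle_point O r (b + t).
Proof.
  intros Hr HX. unfold circle in HX.
  pose proof (distance_sqr O X) as H. rewrite HX in H.
  destruct O as [o1 o2], X as [x1 x2]; simpl in *.
  pose proof (sin2_cos2 b) as Hb. unfold Rsqr in Hb.
  (* These are the coordinates of [(X - O) / r] in the frame rotated by [b]. *)
  destruct (unit_vector_angle
    (((x1 - o1) * cos b + (x2 - o2) * sin b) / r)
    (((x2 - o2) * cos b - (x1 - o1) * sin b) / r)) as (t & Ht & Hc & Hs).
  - transitivity (((o1 - x1) ^ 2 + (o2 - x2) ^ 2)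
                  * (sin b * sin b + cos b * cos b) / r ^ 2); [field; lra|].
    rewrite Hb. simpl. rewrite <- H. field. lra.
  - exists t. split; [assumption|].
    unfold circle_point; simpl. rewrite cos_plus, sin_plus, Hc, Hs.
    f_equal.
    + transitivity (o1 + (x1 - o1) * (sin b * sin b + cos b * cos b));
        [rewrite Hb; ring | field; lra].
    + transitivity (o2 + (x2 - o2) * (sin b * sin b + cos b * cos b));
        [rewrite Hb; ring | field; lra].
Qed.

Theorem theorem2p5
  (O A B C D E L : point) (r : R) (l m : point -> Prop)
  (hr : 0 < r)
  (hAB : is_diameter O r A B)
  (hCAB : between C A B)
  (hAC : distance A C = r)
  (hl : is_line l)
  (hlC : l C)
  (hlAB : ~ same_set l (line A B))
  (hD : l D /\ circle O r D)
  (hE : l E /\ circle O r E)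
  (hDE : distance C D < distance C E)
  (hm : is_tangent_at O r B m)
  (hL : l L /\ m L) :
  distance B L < minor_arc_length O r B E.
Proof.
  clear hD hDE.
  destruct hE as [hlE hOE], hL as [hlL hmL].
  pose proof (produced_diameter_point _ _ _ _ _ hr hAB hCAB hAC) as HC.
  pose proof (diameter_midpoint _ _ _ _ hAB) as HO.
  pose proof (tangent_orthogonal _ _ _ _ _ hm hmL) as Horth.
  destruct hAB as (_ & hOB & _).
  destruct (circle_point_polar O B r 0 hr hOB) as (b & _ & HB).
  rewrite Rplus_0_l in HB.
  destruct (circle_point_polar O E r b hr hOE) as (phi & Hphi & HE).
  pose proof (sin2_cos2 b) as Hb. pose proof (sin2_cos2 phi) as Hsc.
  unfold Rsqr in Hb, Hsc. pose proof (COS_bound phi) as Hcb.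
  (* [C] is at distance [2 * r] from [O], but [E] at distance [r]. *)
  assert (HCE : C <> E).
  { intros HCE. rewrite <- HCE in hOE. unfold circle in hOE, hOB.
    pose proof (distance_sqr O C) as H1. pose proof (distance_sqr O B) as H2.
    rewrite hOE, HC in H1. rewrite hOB in H2. simpl in H1, H2. nra. }
  pose proof (is_line_through l C E hl HCE hlC hlE) as HlCE.
  (* Otherwise [E] would lie on [A B], and [l] would be that line. The witnesses are the parameters
     of [C] and [E] on [A B]. *)
  assert (Hsin : sin phi <> 0).
  { intros Hs. apply hlAB. intros X.
    rewrite (HlCE X). symmetry. apply line_unique; [assumption| |].
    - exists (- 1 / 2). rewrite HC, HO at 1.
      unfold affine_point; simpl; f_equal; field.
    - exists ((1 + cos phi) / 2).
      assert (HEB : E = affine_point O B (cos phi)).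
      { rewrite HE, HB. unfold affine_point, circle_point; simpl.
        rewrite cos_plus, sin_plus, Hs. f_equal; ring. }
      rewrite HEB, HO at 1. unfold affine_point; simpl; f_equal; field. }
  apply HlCE in hlL. destruct hlL as [t HLt].
  assert (HBL : distance B L = r * (3 * Rabs (sin phi) / (2 + cos phi))).
  { assert (Ht : t = 3 / (2 + cos phi)).
    { rewrite HLt, HC, HE, HB in Horth. simpl in Horth.
      rewrite cos_plus, sin_plus in Horth.
      assert (H : r * r * (t * (2 + cos phi) - 3)
                  * (sin b * sin b + cos b * cos b) = 0) by nra.
      rewrite Hb in H.
      assert (t * (2 + cos phi) - 3 = 0)
        by (apply (Rmult_eq_reg_l (r * r)); nra).
      apply (Rmult_eq_reg_r (2 + cos phi)); [|lra].
      field_simplify; lra. }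
    apply distance_eq.
    - apply Rmult_le_pos; [lra|]. apply Rdiv_le_0_compat; [|lra].
      pose proof (Rabs_pos (sin phi)); lra.
    - rewrite HLt, HC, HE, HB, Ht. simpl fst; simpl snd.
      rewrite cos_plus, sin_plus.
      replace ((r * (3 * Rabs (sin phi) / (2 + cos phi))) ^ 2)
        with ((r * (3 / (2 + cos phi))) ^ 2 * Rabs (sin phi) ^ 2)
        by (field; lra).
      rewrite <- (Rsqr_pow2 (Rabs _)), <- Rsqr_abs. unfold Rsqr.
      transitivity ((r * (3 / (2 + cos phi))) ^ 2 * (sin phi * sin phi)
                    * (sin b * sin b + cos b * cos b)); [field; lra|].
      rewrite Hb. ring. }
  (* A nonzero [phi] makes Snell-Cusanus strict; excluding [PI] and [- PI] keeps [B] and [E] from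
     being antipodal, where no minor arc exists. *)
  assert (Hne : phi <> 0 /\ phi <> PI /\ phi <> - PI).
  { repeat split; intros H; apply Hsin; rewrite H, ?sin_neg;
      rewrite ?sin_0, ?sin_PI; ring. }
  apply Rlt_le_trans with (r * Rabs phi).
  - rewrite HBL. apply Rmult_lt_compat_l; [assumption|].
    apply (Rmult_lt_reg_r (2 + cos phi)); [lra|].
    replace (3 * Rabs (sin phi) / (2 + cos phi) * (2 + cos phi))
      with (3 * Rabs (sin phi)) by (field; lra).
    destruct (Rle_lt_dec 0 phi).
    + rewrite !Rabs_pos_eq by (try apply sin_ge_0; lra).
      apply snell_cusanus; lra.
    + rewrite <- (Rabs_Ropp (sin phi)), <- (Rabs_Ropp phi), <- sin_neg.
      rewrite <- (cos_neg phi).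
      rewrite !Rabs_pos_eq by (try apply sin_ge_0; lra).
      apply snell_cusanus; lra.
  - destruct (Rle_lt_dec 0 phi).
    + rewrite Rabs_pos_eq by assumption.
      apply minor_arc_length_ge with b; [lra|lra|].
      left; split; symmetry; assumption.
    + rewrite Rabs_left by assumption.
      (* For negative [phi] the counterclockwise arc starts at [E] and ends at [B]. *)
      apply minor_arc_length_ge with (b + phi); [lra|lra|].
      right. replace (b + phi + - phi) with b by ring.
      split; symmetry; assumption.
Qed.
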